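(* For every fixed integer $d\ge 1$, the problem $d$-Cut is solvable in polynomial time on bipartite graphs of radius at most $2$.
   Context: Graphs are finite, simple and undirected. The distance $\mathrm{dist}(u,v)$ is the length of a shortest path from $u$ to $v$; a graph has radius at most $r$ if there is a vertex $v$ such that $\mathrm{dist}(v,u)\le r$ for all vertices $u$ (in particular such a graph is connected). For a fixed integer $d\ge 1$, a graph $G$ has a $d$-cut if $V(G)$ can be partitioned into two non-empty sets $A$ and $B$ such that every vertex in $A$ is adjacent to at most $d$ vertices in $B$ and every vertex in $B$ is adjacent to at most $d$ vertices in $A$. The decision problem $d$-Cut (with $d$ fixed, not part of the input) takes a graph $G$ as input and asks whether $G$ has a $d$-cut. *)

(* Defs.v *)
From HB Require Import structures.
From mathcomp Require Import all_boot all_order all_algebra.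
Set Implicit Arguments.
Unset Strict Implicit.
Unset Printing Implicit Defensive.

Local Open Scope nat_scope.

Record graph := Graph {
  vertex : finType;
  adj : rel vertex;
  adj_sym : symmetric adj;
  adj_irrefl : irreflexive adj
}.

Definition is_path (G : graph) (u v : vertex G) (p : seq (vertex G)) : bool :=
  [&& path (@adj G) u p, last u p == v & uniq (u :: p)].

(* [dist u v] is a relation rather than a function because it is undefined
   when [v] is not reachable from [u].  The path is [u :: p], so its length
   (number of edges) is [size p]. *)
Definition is_dist (G : graph) (u v : vertex G) (k : nat) : Prop :=
  (exists2 p, is_path u v p & size p = k) /\
  (forall p, is_path u v p -> k <= size p).

Definition radius_at_most (G : graph) (r : nat) : Prop :=
  exists v : vertex G, forall u : vertex G, exists2 k, is_dist v u k & k <= r.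

Definition bipartite (G : graph) : Prop :=
  exists X : {set vertex G},
    forall u v : vertex G, adj u v -> (u \in X) != (v \in X).

Definition nb_adj (G : graph) (u : vertex G) (S : {set vertex G}) : nat :=
  #|[set v in S | adj u v]|.

Definition has_dcut (d : nat) (G : graph) : Prop :=
  exists A B : {set vertex G},
    [/\ A :|: B = setT, [disjoint A & B], A != set0, B != set0 &
        {in A, forall u, nb_adj u B <= d} /\ {in B, forall u, nb_adj u A <= d}].

(* The order [n] of the graph in unary, as [1^n 0], followed by the
   [n * n] entries of the adjacency matrix, row by row.  The vertices are
   listed in the order of [enum]; as [vertex G] is an arbitrary finite type,
   every numbering of the vertices of every graph occurs. *)
Definition encode (G : graph) : seq bool :=
  nseq #|vertex G| true ++
  false :: [seq adj u v | u <- enum (vertex G), v <- enum (vertex G)].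

Inductive move := MoveLeft | Stay | MoveRight.

(* A deterministic multi-tape Turing machine with two-way infinite tapes.
   The tape alphabet is [option (bool + work)]: [None] is the blank,
   [Some (inl b)] are the two input symbols, [Some (inr s)] the further work
   symbols.  A state [q] is halting when [verdict q] is [Some b]; it is
   accepting if [b] is [true] and rejecting if [b] is [false]. *)
Record machine := Machine {
  state : finType;
  tape : finType;
  work : finType;
  start : state;
  input_tape : tape;
  verdict : state -> option bool;
  delta : state -> {ffun tape -> option (bool + work)} ->
          state * {ffun tape -> option (bool + work) * move}
}.

Definition symbol (M : machine) : Type := option (bool + work M).

Record config (M : machine) := Config {
  cur_state : state M;
  content : tape M -> int -> symbol M;
  head_pos : tape M -> int
}.

Definition shift (m : move) (z : int) : int :=
  match m with
  | MoveLeft => (z - 1)%R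
  | Stay => z
  | MoveRight => (z + 1)%R
  end.

Definition step (M : machine) (c : config M) : config M :=
  if verdict (cur_state c) is Some _ then c else
  let: (q, act) :=
    delta (cur_state c) [ffun i => content c i (head_pos c i)] in
  {| cur_state := q;
     content := fun i z =>
       if z == head_pos c i then (act i).1 else content c i z;
     head_pos := fun i => shift (act i).2 (head_pos c i) |}.

(* The input occupies the cells [0, ..., size w - 1] of the input tape. *)
Definition init (M : machine) (w : seq bool) : config M :=
  {| cur_state := start M;
     content := fun i z =>
       if i != input_tape M then None else
       match z with
       | Posz k => omap inl (onth w k)
       | Negz _ => None
       end;
     head_pos := fun _ => 0%R |}.

Definition halts_with (M : machine) (w : seq bool) (t : nat) (b : bool) : Prop :=
  verdict (cur_state (iter t (@step M) (init M w))) = Some b.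

(* The decision problem [Q], with its inputs promised to lie in the class
   [C], is solvable in polynomial time in the length of the encoded input. *)
Definition poly_time_solvable_on (I : Type) (enc : I -> seq bool)
    (C Q : I -> Prop) : Prop :=
  exists (M : machine) (p : {poly nat}),
    forall x : I, C x ->
      exists t b, [/\ t <= (p.[size (enc x)])%R,
                      halts_with M (enc x) t b & b <-> Q x].

(* Main.v *)
From HB Require Import structures.
From mathcomp Require Import all_boot all_order all_algebra zify.
Require Import Defs.

(** A d-cut of a bipartite graph of radius at most 2 can be replaced by one
    that is determined by boundedly many vertices.  Let [v] be a center and
    [B] the side of a d-cut that avoids [v].  As the graph is bipartite of
    radius 2, being a neighbour of [v] is a proper 2-colouring.  At most [d]
    neighbours of [v] lie in [B]; call their set [D].  If [D] is empty, any
    vertex of [B] has all its neighbours outside [B], hence at most [d] of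
    them, and alone forms one side of a d-cut.  Otherwise let [R] be the set of
    the neighbours of [D] outside [B], of which there are at most [d * d].
    Dropping from [B] the vertices that are neither in [D] nor adjacent to [D]
    leaves a d-cut, because the neighbours of such a vertex are all neighbours
    of [v] outside [D], hence outside [B].  What is left is the closed
    neighbourhood of [D] minus [R].  So a d-cut exists if and only if there are
    [d + d * d] vertices [x_i], [y_j] such that the closed neighbourhood of
    the [x_i] minus the [y_j] is one side of a d-cut ([dcut_few_vertices]).

    For fixed [d] this is a first-order property of the graph, because a vertex
    has too many neighbours across the cut when some [d + 1] distinct
    neighbours lie across ([has_cutP]).  First-order properties are
    decided in polynomial time by running each quantifier through all vertices.

    The machine has one tape for each variable, holding [n] marks; the value of
    the variable is the position of the head among the marks.  Two more tapes
    are used for counting, and the adjacency matrix is only ever read on the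
    input tape.  Machines are built from fragments, which have a finite
    control but leave with a result instead of halting, and which are
    composed sequentially and iterated.  The atomic formulas are decided by
    moving heads in parallel ([does_leq_frag], [does_adj_frag]), and the
    formulas decided by polynomially bounded fragments are closed under
    Boolean connectives and quantifiers ([computable_case], [computable_ex]). *)

Set Implicit Arguments.
Unset Strict Implicit.
Unset Printing Implicit Defensive.

Import GRing.Theory Num.Theory.

Local Open Scope nat_scope.

(** * Cuts determined by boundedly many vertices *)

Definition crossing G (B : {set vertex G}) (u : vertex G) : {set vertex G} :=
  [set z | adj u z & (z \in B) != (u \in B)].

Definition dcut d G (B : {set vertex G}) :=
  [/\ exists z, z \in B, exists z, z \notin B & forall u, #|crossing B u| <= d].

Lemma has_dcutP d G : has_dcut d G <-> exists B : {set vertex G}, dcut d B.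
Proof.
split=> [[A [B [ABT dAB /set0Pn[a aA] /set0Pn[b bB] [dA dB]]]] | [B [[b bB] [a aB] dB]]].
  have AE : A = ~: B.
    apply/setP => z; rewrite inE; have := in_setT z; rewrite -ABT inE.
    by case zB: (z \in B); rewrite ?orbF ?orbT // => _; apply: (disjointFl dAB).
  have {}aA : a \notin B by move: aA; rewrite AE inE.
  exists B; split; [by exists b | by exists a | move=> u].
  case uB: (u \in B); [apply: leq_trans (dB u uB) | apply: leq_trans (dA u _)].
  - rewrite subset_leq_card //; apply/subsetP => z; rewrite !inE AE inE uB.
    by case: (z \in B); rewrite ?andbF // andbT.
  - rewrite subset_leq_card //; apply/subsetP => z; rewrite !inE uB.
    by case: (z \in B); rewrite ?andbF // andbT.
  - by rewrite AE inE uB.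
exists (~: B), B; split.
- by rewrite setUC setUCr.
- by rewrite disjoints_subset.
- by apply/set0Pn; exists a; rewrite inE.
- by apply/set0Pn; exists b.
split=> u; rewrite ?inE => uB; apply: leq_trans (dB u).
  rewrite subset_leq_card //; apply/subsetP => z; rewrite !inE (negbTE uB).
  by case: (z \in B); rewrite // andbT.
rewrite subset_leq_card //; apply/subsetP => z; rewrite !inE uB.
by case: (z \in B); rewrite // andbT.
Qed.

Lemma dcutC d G (B : {set vertex G}) : dcut d B -> dcut d (~: B).
Proof.
move=> [[b bB] [a aB] dB]; split.
- by exists a; rewrite inE.
- by exists b; rewrite inE bB.
move=> u; apply: leq_trans (dB u); rewrite subset_leq_card //.
by apply/subsetP => z; rewrite !inE; case: (z \in B) (u \in B) => -[].
Qed.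

(** The colour class of [u] is read off its distance to the center: it is the
    class of [v] exactly when the distance is 0 or 2, so the neighbours of [v]
    are the whole other class. *)
Lemma center_colors G : bipartite G -> radius_at_most G 2 ->
  exists v : vertex G, (forall u z, adj u z -> adj v u != adj v z) /\
    forall u, u != v -> exists z, adj u z.
Proof.
move=> [X biX] [v rad]; exists v.
have Hv z : [\/ z = v, adj v z | exists2 w, adj v w & adj w z].
  have [k [[p /and3P[pth /eqP lst _] szp] _]] := rad z.
  case: p pth lst szp => [|w [|w' [|]]] /=; rewrite ?andbT.
  - by move=> _ -> _ _; constructor 1.
  - by move=> vw <- _ _; constructor 2.
  - by move=> /andP[vw ww'] <- _ _; constructor 3; exists w.
  - by move=> a l _ _ <-.
have adjX z : adj v z = ((v \in X) != (z \in X)).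
  apply/idP/idP => [/biX //|]; case: (Hv z) => [-> | // | [w /biX + /biX]]; first by rewrite eqxx.
  by case: (v \in X) (w \in X) (z \in X) => -[] [].
split=> [u z /biX | u].
  by rewrite !adjX; case: (v \in X) (u \in X) (z \in X) => -[] [].
case: (Hv u) => [-> | | [w _ wu] _]; first by rewrite eqxx.
  by exists v; rewrite adj_sym.
by exists w; rewrite adj_sym.
Qed.

Definition cut_side G (D R : seq (vertex G)) : {set vertex G} :=
  [set z | has (fun x => (z == x) || adj x z) D & z \notin R].

(** Padding gives the witnesses an exact length, so that they fit a fixed
    number of variables. *)
Lemma pad_seq (T : eqType) (s : seq T) x n : x \in s -> size s <= n ->
  exists2 s', size s' = n & s' =i s.
Proof.
move=> xs le_n; exists (s ++ nseq (n - size s) x).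
  by rewrite size_cat size_nseq subnKC.
move=> y; rewrite mem_cat mem_nseq; case: eqP => [-> | _]; last by rewrite andbF orbF.
by rewrite xs.
Qed.

Lemma eq_cut_side G (D R D' R' : seq (vertex G)) : D =i D' -> R =i R' ->
  cut_side D R = cut_side D' R'.
Proof. by move=> HD HR; apply/setP => z; rewrite !inE (eq_has_r HD) HR. Qed.

(** Here [D] consists of the neighbours of the center in the side of the cut
    that avoids it, or of a single vertex of that side if there are none, and
    [R] consists of the neighbours of [D] on the other side. *)
Lemma dcut_few_vertices d G : 0 < d -> bipartite G -> radius_at_most G 2 ->
    has_dcut d G ->
  exists D R : seq (vertex G), [/\ size D = d, size R = d * d & dcut d (cut_side D R)].
Proof.
move=> d0 biG radG /has_dcutP[B0 dB0].
have [v [col nb]] := center_colors biG radG.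
have [B [dB vB]] : exists B, dcut d B /\ v \notin B.
  case vB0: (v \in B0); last by exists B0; rewrite vB0.
  by exists (~: B0); split; [apply: dcutC | rewrite inE vB0].
suff [D [R [[x xD] [y yR] szD szR dDR]]] : exists D R : seq (vertex G),
    [/\ exists x, x \in D, exists y, y \in R, size D <= d, size R <= d * d & dcut d (cut_side D R)].
  have [D' szD' DD'] := pad_seq xD szD; have [R' szR' RR'] := pad_seq yR szR.
  by exists D', R'; split=> //; rewrite (eq_cut_side DD' RR').
have [[b bB] _ dBu] := dB.
pose D := [set z in B | adj v z].
have leD : #|D| <= d.
  apply: leq_trans (dBu v); rewrite subset_leq_card //; apply/subsetP => z.
  by rewrite !inE (negbTE vB) => /andP[-> ->].
have [D0 | [w wD]] := set_0Vmem D.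
  (* Without neighbours of [v] in [B], a single vertex of [B] is a side. *)
  have bv : b != v by apply: contraNneq vB => <-.
  have nbB z : adj b z -> z \notin B.
    move=> bz; apply/negP => zB; have := col _ _ bz.
    have notD y : y \in B -> adj v y = false.
      by move=> yB; have := in_set0 y; rewrite -D0 inE yB.
    by rewrite !notD.
  have leN : #|[set z | adj b z]| <= d.
    apply: leq_trans (dBu b); rewrite subset_leq_card //; apply/subsetP => z.
    by rewrite !inE bB => bz; rewrite bz (negbTE (nbB z bz)).
  exists [:: b], (enum [set z | adj b z]); split.
  - by exists b; rewrite inE.
  - by have [y by_] := nb b bv; exists y; rewrite mem_enum inE.
  - by [].
  - by rewrite -cardE (leq_trans leN) // leq_pmulr.
  have -> : cut_side [:: b] (enum [set z | adj b z]) = [set b].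
    apply/setP => z; rewrite !inE mem_enum inE /= orbF.
    by case: eqP => [->|_] /=; [rewrite adj_irrefl | case: adj].
  split; [by exists b; rewrite inE | by exists v; rewrite inE eq_sym | move=> u].
  have [-> | ub] := eqVneq u b.
    by apply: leq_trans leN; rewrite subset_leq_card //; apply/subsetP => z; rewrite !inE => /andP[].
  apply: leq_trans d0; rewrite -(cards1 b) subset_leq_card //; apply/subsetP => z.
  by rewrite !inE (negbTE ub) => /andP[_]; case: (z == b).
pose R := \bigcup_(x in D) crossing B x.
have DB x : x \in D -> x \in B by rewrite inE => /andP[].
have RE z : (z \in R) = (z \notin B) && [exists x in D, adj x z].
  apply/bigcupP/andP => [[x xD] | [zB /exists_inP[x xD xz]]].
    rewrite inE (DB x xD) => /andP[xz]; rewrite eqb_id => zB; split=> //.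
    by apply/exists_inP; exists x.
  by exists x => //; rewrite inE xz (DB x xD) (negbTE zB).
have leR : #|R| <= d * d.
  apply: leq_trans (leq_mul leD (leqnn d)); rewrite -sum_nat_const /R.
  elim/big_rec2: _ => [|x S1 S2 _ IH]; first by rewrite cards0.
  exact: leq_trans (leq_card_setU _ _) (leq_add (dBu x) IH).
have vw : adj v w by move: wD; rewrite inE => /andP[].
exists (enum D), (enum R); split.
- by exists w; rewrite mem_enum.
- exists v; rewrite mem_enum RE vB; apply/exists_inP; exists w => //.
  by rewrite adj_sym.
- by rewrite -cardE.
- by rewrite -cardE.
set B' := cut_side _ _.
have B'E z : (z \in B') = (z \in B) && ((z \in D) || [exists x in D, adj x z]).
  rewrite inE mem_enum RE.
  have -> : has (fun x => (z == x) || adj x z) (enum D) = (z \in D) || [exists x in D, adj x z].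
    apply/hasP/orP => [[x] | [zD | /exists_inP[x xD xz]]].
    - rewrite mem_enum => xD /orP[/eqP->|xz]; [by left | right].
      by apply/exists_inP; exists x.
    - by exists z; rewrite ?mem_enum ?eqxx.
    - by exists x; rewrite ?mem_enum // xz orbT.
  case zD: (z \in D) => /=; first by rewrite DB.
  by case: (z \in B); case: [exists x in D, adj x z].
have BB' z : z \notin B -> z \notin B' by move=> zB; rewrite B'E (negbTE zB).
split; [by exists w; rewrite B'E DB // wD | by exists v; apply: BB' | move=> u].
apply: leq_trans (dBu u); rewrite subset_leq_card //; apply/subsetP => z.
rewrite inE => /andP[uz neq]; rewrite inE uz /=.
have nbD x y : x \in D -> adj x y -> [exists x in D, adj x y].
  by move=> xD xy; apply/exists_inP; exists x.
have zu : adj z u by rewrite adj_sym.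
have colz := col _ _ uz.
have DE y : (y \in D) = (y \in B) && adj v y by rewrite inE.
(* A pair that straddles [B'] but not [B] lies in [B]: its vertex outside [B']
   would be adjacent to [D], or a neighbour of [v], hence in [D]. *)
move: neq; rewrite !B'E.
case zB: (z \in B); case uB: (u \in B) => //=.
have [uD | uD] := boolP (u \in D); have [zD | zD] := boolP (z \in D); rewrite ?orbT //=.
- by rewrite (nbD _ _ uD uz).
- by rewrite (nbD _ _ zD zu).
move: uD zD colz; rewrite !DE uB zB /=.
by case: (adj v u); case: (adj v z).
Qed.

(** * Program fragments *)

Notation sym := (option (bool + void)).

Section Fragments.

Variable T : finType.

(** A Turing machine that leaves its control with a result in [E] instead of
    halting; the step that leaves still writes and moves. *)
Record frag (E : Type) := Frag {
  fstate : finType;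
  fstart : fstate;
  fdelta : fstate -> {ffun T -> sym} -> (fstate + E) * {ffun T -> sym * move}
}.

Record tapes := Tapes { cells : T -> int -> sym; heads : T -> int }.

Definition scan (s : tapes) : {ffun T -> sym} := [ffun i => cells s i (heads s i)].

Definition act (a : {ffun T -> sym * move}) (s : tapes) : tapes :=
  Tapes (fun i z => if z == heads s i then (a i).1 else cells s i z)
        (fun i => shift (a i).2 (heads s i)).

(** [run e s' q s t]: from state [q] on tapes [s], the fragment leaves after
    exactly [t] steps with result [e] and tapes [s']. *)
Inductive run E (F : frag E) (e : E) (s' : tapes) : fstate F -> tapes -> nat -> Prop :=
| run_exit q s a : fdelta q (scan s) = (inr e, a) -> s' = act a s -> run e s' q s 1
| run_step q s q' a t : fdelta q (scan s) = (inl q', a) ->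
    run e s' q' (act a s) t -> run e s' q s t.+1.

(** Total correctness with a time bound.  Every specification below is a
    statement of this form, so termination is never argued separately. *)
Definition does E (F : frag E) (s : tapes) (t : nat) (Q : E -> tapes -> Prop) :=
  exists t' e s', [/\ t' <= t, run e s' (fstart F) s t' & Q e s'].

Definition atom E (f : {ffun T -> sym} -> E * {ffun T -> sym * move}) : frag E :=
  @Frag E unit tt (fun _ r => let: (e, a) := f r in (inr e, a)).

Definition later (E : finType) E' (K : E -> frag E') e (q : fstate (K e)) :
    {e : E & fstate (K e)} := Tagged (fun e => fstate (K e)) q.

(** The step in which the first fragment leaves enters the second one, so that
    running times just add up. *)
Definition bind_delta (E : finType) E' (F : frag E) (K : E -> frag E')
    (q : fstate F + {e : E & fstate (K e)}) (r : {ffun T -> sym}) :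
    ((fstate F + {e : E & fstate (K e)}) + E') * {ffun T -> sym * move} :=
  match q with
  | inl q => let: (x, a) := fdelta q r in
             (inl match x with inl q' => inl q' | inr e => inr (later (fstart (K e))) end, a)
  | inr (existT e q) => let: (x, a) := fdelta q r in
             (match x with inl q' => inl (inr (later q')) | inr e' => inr e' end, a)
  end.

Definition bind (E : finType) E' (F : frag E) (K : E -> frag E') : frag E' :=
  @Frag E' (fstate F + {e : E & fstate (K e)})%type (inl (fstart F)) (@bind_delta E E' F K).

(** The result [None] of the body asks for another iteration. *)
Definition loop_delta E (F : frag (option E)) (q : fstate F) (r : {ffun T -> sym}) :
    (fstate F + E) * {ffun T -> sym * move} :=
  let: (x, a) := fdelta q r in
  (match x with
   | inl q' => inl q' | inr None => inl (fstart F) | inr (Some e) => inr e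
   end, a).

Definition loop E (F : frag (option E)) : frag E := Frag (fstart F) (@loop_delta E F).

Lemma does_weak E (F : frag E) s t t' Q Q' :
  does F s t Q -> t <= t' -> (forall e s', Q e s' -> Q' e s') -> does F s t' Q'.
Proof.
move=> [u [e [s' [le_ut R Qe]]]] le_tt' QQ'; exists u, e, s'.
by split=> //; [apply: leq_trans le_tt' | apply: QQ'].
Qed.

Lemma does_atom E f s (Q : E -> tapes -> Prop) :
  Q (f (scan s)).1 (act (f (scan s)).2 s) -> does (atom f) s 1 Q.
Proof.
move=> Qs; exists 1, (f (scan s)).1, (act (f (scan s)).2 s); split=> //.
by apply: (@run_exit _ _ _ _ _ s (f (scan s)).2) => //=; case: (f _).
Qed.

(** The continuation is specified with the remaining time, so that a chain of
    fragments is verified from left to right against one global bound. *)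
Lemma does_bind (E : finType) E' (F : frag E) (K : E -> frag E') s t u Q R :
    does F s t Q -> t <= u ->
    (forall e s', Q e s' -> does (K e) s' (u - t) R) ->
  does (bind F K) s u R.
Proof.
move=> [t1 [e [s1 [le_t1 R1 Qe]]]] le_tu /(_ _ _ Qe) [t2 [e' [s2 [le_t2 R2 Qe']]]].
exists (t1 + t2), e', s2; split=> //; first by lia.
rewrite [fstart _]/=; elim: R1 => {le_t1} => [q {}s a qe s1E | q {}s q' a t' qq' _ IH].
- apply: (@run_step _ (bind F K) _ _ _ _ (inr (later (fstart (K e)))) a); first by rewrite /= qe.
  rewrite -s1E; elim: R2 {Qe qe le_t2 s1E} => [q1 {}s1 a1 q1e s2E | q1 {}s1 q1' a1 t' qq' _ IH].
    by apply: run_exit s2E; rewrite /= q1e.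
  by apply: run_step IH; rewrite /= qq'.
- by apply: run_step IH; rewrite /= qq'.
Qed.

(** The index of the invariant [I] is a variant: it bounds the number of
    iterations that are left, hence also the running time. *)
Lemma does_loop E (F : frag (option E)) (I : nat -> tapes -> Prop) t Q :
    (forall j s, I j s -> does F s t (fun o s' =>
       if o is Some e then Q e s' else exists2 i, i < j & I i s')) ->
  forall j s, I j s -> does (loop F) s (j.+1 * t) Q.
Proof.
move=> HI j; elim/ltn_ind: j => j IH s /HI [t1 [o [s1 [le_t1 R1 Qo]]]].
(* A name for the start state that is protected from the induction on the run. *)
have [q0 q0E] : exists q0, q0 = fstart F by eexists.
have [t2 [e [s2 [le_t2 Qe Hrun]]]] : exists t2 e s2, [/\ t2 <= j * t, Q e s2 &
   if o is Some e' then e = e' /\ s2 = s1 /\ t2 = 0 else run (F := loop F) e s2 q0 s1 t2].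
  case: o Qo {R1} => [e Qe | [i lt_ij /(IH _ lt_ij) [t2 [e [s2 [le_t2 R2 Qe]]]]]].
    by exists 0, e, s1.
  exists t2, e, s2; rewrite q0E; split=> //; apply: leq_trans le_t2 _.
  by rewrite leq_mul2r lt_ij orbT.
exists (t1 + t2), e, s2; split=> //; first by rewrite mulSn leq_add.
rewrite [fstart _]/=; elim: R1 Hrun => [q {}s a qe s1E | q {}s q' a t' qq' _ IHr] Hrun.
- case: o qe Hrun {Qo} => [e'|] qe Hrun; last first.
    apply: (@run_step _ (loop F) _ _ _ _ (fstart F) a); last by rewrite -s1E -q0E.
    by rewrite /= /loop_delta qe.
  case: Hrun => -> [-> ->].
  by apply: run_exit s1E; rewrite /= /loop_delta qe.
- by apply: run_step (IHr Hrun); rewrite /= /loop_delta qq'.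
Qed.

Definition frag_machine (F : frag bool) (i : T) : machine :=
  @Machine (fstate F + bool)%type T void (inl (fstart F)) i
    (fun q => if q is inr b then Some b else None)
    (fun q r => if q is inl q' then fdelta q' r else (q, [ffun=> (None, Stay)])).

Definition of_tapes F i (q : fstate F + bool) (s : tapes) : config (frag_machine F i) :=
  @Config (frag_machine F i) q (cells s) (heads s).

(** What turns the specification of a fragment into a statement about a machine
    whose verdict is the result of the fragment. *)
Lemma does_iter F i s t Q : does F s t Q ->
  exists t' b s', [/\ t' <= t,
    verdict (cur_state (iter t' (@step _) (of_tapes i (inl (fstart F)) s))) = Some b & Q b s'].
Proof.
move=> [u [b [s' [le_ut R Qb]]]]; exists u, b, s'; split=> //.
elim: R => [q {}s a qb _ | q {}s q' a u' qq' _ IH].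
  by rewrite /= /step /= -/(scan s) qb.
rewrite iterSr -[RHS]IH; congr (verdict (cur_state (iter _ _ _))).
by rewrite /step /= -/(scan s) qq'.
Qed.

(** * Moving heads over unchanged tapes *)

Definition cell (w : seq bool) (z : int) : sym :=
  if z is Posz k then omap inl (onth w k) else None.

(** Pointwise, because tapes and positions are functions on which a run is
    specified only up to extensionality. *)
Definition tapes_at (W : T -> seq bool) (p : T -> int) (s : tapes) :=
  (forall i z, cells s i z = cell (W i) z) /\ (forall i, heads s i = p i).

(** The heads after [N] moves to the left of those in [L] and to the right of
    those in [R].  Positions are integers, so no head can hit a border. *)
Definition moved (L R : seq T) (N : nat) (p : T -> int) (i : T) : int :=
  if i \in L then (p i - N%:Z)%R else if i \in R then (p i + N%:Z)%R else p i.

Definition walk E (f : {ffun T -> sym} -> E * seq T * seq T) : frag E :=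
  atom (fun r => let: (e, L, R) := f r in
    (e, [ffun i => (r i, if i \in L then MoveLeft else if i \in R then MoveRight else Stay)])).

Definition go E (L R : seq T) (e : E) : frag E := walk (fun _ => (e, L, R)).

Definition peek (i : T) : frag bool := walk (fun r => (r i == Some (inl true), [::], [::])).

Definition after (E : finType) E' (F : frag E) (F' : frag E') := bind F (fun _ => F').

(** The head of [i], which should be among the moving ones, controls how far
    the others go; heads that move the same way keep their distances, and heads
    that move the opposite way record the number of steps. *)
Definition sweep (i : T) (L R : seq T) : frag unit :=
  loop (walk (fun r => if r i then (None, L, R) else (Some tt, [::], [::]))).

Lemma tapes_at_eq W p q s : tapes_at W p s -> p =1 q -> tapes_at W q s.
Proof. by move=> [Ws ps] pq; split=> // i; rewrite ps pq. Qed.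

Lemma does_walk E (f : _ -> E * seq T * seq T) W p s (Q : E -> tapes -> Prop) :
    tapes_at W p s ->
    (let: (e, L, R) := f [ffun i => cell (W i) (p i)] in
     forall s', tapes_at W (moved L R 1 p) s' -> Q e s') ->
  does (walk f) s 1 Q.
Proof.
move=> [Ws ps] HQ; apply: does_atom.
have -> : scan s = [ffun i => cell (W i) (p i)].
  by apply/ffunP => i; rewrite !ffunE Ws ps.
case: (f _) HQ => [[e L] R] /= HQ; apply: HQ.
split=> [i z | i] /=; rewrite !ffunE /=; last first.
  by rewrite /moved ps; case: (i \in L) => //; case: (i \in R).
by case: eqP => [->|_]; rewrite ?ps ?Ws.
Qed.

Lemma does_go E L R p' (e : E) W p s u (Q : E -> tapes -> Prop) :
    tapes_at W p s -> moved L R 1 p =1 p' -> 0 < u ->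
    (forall s', tapes_at W p' s' -> Q e s') ->
  does (go L R e) s u Q.
Proof.
move=> Hs pp' u0 HQ; apply: (does_weak (t := 1)) u0 (fun _ _ H => H).
by apply: does_walk Hs _ => s' Hs'; apply/HQ/(tapes_at_eq Hs').
Qed.

Lemma does_after_go p' (E : finType) E' L R (e : E) (F : frag E') W p s u Q :
    tapes_at W p s -> moved L R 1 p =1 p' -> 0 < u ->
    (forall s', tapes_at W p' s' -> does F s' u.-1 Q) ->
  does (after (go L R e) F) s u Q.
Proof.
move=> Hs pp' u0 HQ; apply: (does_bind (Q := fun _ => tapes_at W p')) u0 _.
  by apply: does_go Hs pp' _ _.
by move=> _ s' Hs'; rewrite subn1; apply: HQ.
Qed.

Lemma does_bind_peek i E (K : bool -> frag E) W p s u Q :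
    tapes_at W p s -> 0 < u ->
    (forall s', tapes_at W p s' -> does (K (cell (W i) (p i) == Some (inl true))) s' u.-1 Q) ->
  does (bind (peek i) K) s u Q.
Proof.
move=> Hs u0 HQ; apply: (does_bind (t := 1) (Q := fun b s' =>
  b = (cell (W i) (p i) == Some (inl true)) /\ tapes_at W p s')) u0 _.
  by apply: does_walk Hs _; rewrite ffunE.
by move=> _ s' [-> Hs']; rewrite subn1; apply: HQ.
Qed.

Lemma does_after_sweep i L R a p' E (F : frag E) W p s u Q :
    tapes_at W p s ->
    (forall j, j <= a -> (cell (W i) (moved L R j p i) : bool) = (j < a)) ->
    moved L R a p =1 p' -> a < u ->
    (forall s', tapes_at W p' s' -> does F s' (u - a.+1) Q) ->
  does (after (sweep i L R) F) s u Q.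
Proof.
move=> Hs Hc pp' lt_au HQ.
apply: (does_bind (t := a.+1) (Q := fun _ => tapes_at W p')) lt_au (fun _ => HQ).
rewrite -[a.+1]muln1.
apply: (@does_loop _ _ (fun j s => j <= a /\ tapes_at W (moved L R (a - j) p) s)); last first.
  split=> //; apply: tapes_at_eq Hs _ => t; rewrite /moved subnn.
  by case: (t \in L); last case: (t \in R); lia.
move=> j {Hs} {}s [le_ja Hs']; apply: does_walk Hs' _; rewrite ffunE Hc ?leq_subr //.
case: ltnP => [lt_aj | le_aj] s' {}Hs'; last first.
  apply: tapes_at_eq Hs' _ => t; rewrite -pp'.
  by have -> : a - j = a by lia.
exists j.-1; first by lia.
split; first by lia.
apply: tapes_at_eq Hs' _ => t; rewrite /moved.
by case: (t \in L); last case: (t \in R); lia.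
Qed.

Lemma does_after_sweep_left a p' i L R E (F : frag E) W p s u Q :
    tapes_at W p s -> i \in L -> (p i + 1 = a%:Z)%R -> a <= size (W i) ->
    moved L R a p =1 p' -> a < u ->
    (forall s', tapes_at W p' s' -> does F s' (u - a.+1) Q) ->
  does (after (sweep i L R) F) s u Q.
Proof.
move=> Hs iL pa le_a; apply: does_after_sweep Hs _ => j le_ja.
rewrite /moved iL; have -> : p i = (a%:Z - 1)%R by lia.
case: ltnP => [lt_ja | le_aj].
  have -> : (a%:Z - 1 - j%:Z)%R = Posz (a - j).-1 by lia.
  transitivity ((a - j).-1 < size (W i)); last by lia.
  by rewrite -onthTE /=; case: onth.
by have -> : (a%:Z - 1 - j%:Z)%R = Negz 0 by lia.
Qed.

Lemma does_after_sweep_right a b p' i L R E (F : frag E) W p s u Q :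
    tapes_at W p s -> i \notin L -> i \in R -> p i = Posz a -> a + b = size (W i) ->
    moved L R b p =1 p' -> b < u ->
    (forall s', tapes_at W p' s' -> does F s' (u - b.+1) Q) ->
  does (after (sweep i L R) F) s u Q.
Proof.
move=> Hs iL iR pa le_a; apply: does_after_sweep Hs _ => j le_jb.
rewrite /moved (negbTE iL) iR pa -PoszD /=.
by rewrite -(ltn_add2l a) le_a -onthTE; case: onth.
Qed.

End Fragments.

(** * Deciding adjacency and order of two vertices *)

Lemma nth_allpairs (A B C : Type) (f : A -> B -> C) s t a b c i j :
  i < size s -> j < size t ->
  nth c [seq f x y | x <- s, y <- t] (i * size t + j) = f (nth a s i) (nth b t j).
Proof.
move=> + lt_j; elim: s i => [|x s IH] [|i] //= lt_i; rewrite nth_cat size_map.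
  by rewrite mul0n lt_j (nth_map b).
by rewrite ltnNge mulSn -addnA leq_addr /= addKn IH.
Qed.

Lemma size_encode G : size (encode G) = #|vertex G|.+1 + #|vertex G| * #|vertex G|.
Proof. by rewrite size_cat /= size_nseq size_allpairs -cardE addnS. Qed.

(** Starting from cell 0, the entry of [x] and [y] is found by moving [n] cells
    once for each cell that is left of, or under, the head of [x], and then one
    cell for each such cell of [y]: the two extra moves skip the header
    [1^n 0] exactly. *)
Lemma onth_encode G (x y : vertex G) :
  onth (encode G) ((enum_rank x).+1 * #|vertex G| + (enum_rank y).+1) = Some (adj x y).
Proof.
have lt_x := ltn_ord (enum_rank x); have lt_y := ltn_ord (enum_rank y).
have -> : (enum_rank x).+1 * #|vertex G| + (enum_rank y).+1 =
    #|vertex G| + (enum_rank x * #|vertex G| + enum_rank y).+1 by rewrite mulSn -addnA !addnS.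
rewrite onth_cat size_nseq ltnNge leq_addr /= addKn [onth _ _]/= onthE.
rewrite (nth_map false) ?size_allpairs -?cardE; last first.
  apply: (@leq_trans ((enum_rank x).+1 * #|vertex G|)); last by rewrite leq_mul2r lt_x orbT.
  by rewrite mulSn addnC ltn_add2r.
have := nth_allpairs (@adj G) x y false (i := enum_rank x) (j := enum_rank y)
  (s := enum (vertex G)) (t := enum (vertex G)).
by rewrite -cardE => -> //; rewrite !nth_enum_rank.
Qed.

Definition nverts (G : graph) : nat := #|vertex G|.

Lemma rank_lt G (x : vertex G) : enum_rank x < nverts G.
Proof. exact: ltn_ord. Qed.

Definition upd (I : eqType) (K : Type) (p : I -> K) i a (j : I) : K := if j == i then a else p j.

Section Evaluation.

Variable m : nat.

(** The input tape, a tape to count to [n], a scratch tape to remember a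
    number, and [m] tapes for variables. *)
Definition tape_name : finType := (option bool + 'I_m)%type.
Notation tin := (inl None : tape_name).
Notation tcount := (inl (Some true) : tape_name).
Notation tscratch := (inl (Some false) : tape_name).
Notation var i := (inr i : tape_name).

(** The contents during the evaluation: once written, they never change, and
    only the heads and the finite control do. *)
Definition words G (i : tape_name) : seq bool :=
  if i == tin then encode G else nseq (nverts G) true.

(** Positions of the heads, given for the input, counting and scratch tapes and
    for the variables. *)
Definition lay (w c t : int) (p : 'I_m -> int) (i : tape_name) : int :=
  match i with
  | inl None => w
  | inl (Some true) => c
  | inl (Some false) => t
  | inr v => p v
  end.

Definition pos G (q : 'I_m -> vertex G) (i : 'I_m) : int := Posz (enum_rank (q i)).

(** The rest position.  The scratch head rests on the blank left of the marks,
    so that a sweep to the left brings it back there. *)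
Notation layout q := (lay 0 0 (-1) (pos q)).

Lemma cell_mark G i z : i != tin -> cell (words G i) z =
  if (0 <= z < Posz (nverts G))%R then Some (inl true) else None.
Proof.
rewrite /words => /negbTE ->; case: z => z //=; rewrite onth_nseq.
by rewrite ltz_nat; case: ltnP.
Qed.

Lemma size_mark G i : i != tin -> size (words G i) = nverts G.
Proof. by rewrite /words => /negbTE ->; rewrite size_nseq. Qed.

(** Both heads move left by one more than the value of [x]; the head of [y] is
    still on a mark exactly when [y] is greater. *)
Definition leq_frag (x y : 'I_m) : frag tape_name bool :=
  after (sweep (var x) [:: var x; var y] [:: tscratch])
  (bind (peek (var y)) (fun b =>
  after (sweep tscratch [:: tscratch] [:: var x; var y])
  (go [::] [::] (~~ b)))).

Lemma eq_var (i j : 'I_m) : (var i == var j) = (i == j).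
Proof. by []. Qed.

(** Equality of two families of positions, tape by tape; [E] lists what is known
    about the variables involved. *)
Ltac by_tape E :=
  case=> [[[|]|]|z]; rewrite /moved ?inE /= ?eq_var /upd; try lia;
  repeat (let zE := fresh in case: eqVneq => [zE|_]; rewrite ?zE ?E //=); lia.

Lemma does_leq_frag G (q : 'I_m -> vertex G) x y s (Q : bool -> tapes _ -> Prop) :
    x != y ->
    tapes_at (words G) (layout q) s ->
    (forall s', tapes_at (words G) (layout q) s' -> Q (enum_rank (q y) <= enum_rank (q x)) s') ->
  does (leq_frag x y) s (2 * nverts G + 4) Q.
Proof.
move=> xy Hs HQ.
have [a aE] : exists a, a = enum_rank (q x) :> nat by eexists.
have [b bE] : exists b, b = enum_rank (q y) :> nat by eexists.
have [lt_a lt_b] : a < nverts G /\ b < nverts G by rewrite aE bE !rank_lt.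
have [px py] : pos q x = Posz a /\ pos q y = Posz b by rewrite /pos aE bE.
have E := (eqxx, negbTE xy, eq_sym y x, px, py).
apply: (does_after_sweep_left (a := a.+1)
  (p' := lay 0 0 (Posz a) (upd (upd (pos q) x (-1)) y (b%:Z - a%:Z - 1))%R)) Hs _ _ _ _ _ _.
- by rewrite !inE eqxx.
- by rewrite /= px; lia.
- by rewrite size_mark.
- by_tape E.
- by lia.
move=> s1 Hs1; apply: (does_bind_peek Hs1); first by lia.
move=> s2 Hs2.
apply: (does_after_sweep_left (a := a.+1) (p' := layout q)) Hs2 _ _ _ _ _ _ => //.
- by rewrite /= -addn1 PoszD.
- by rewrite size_mark.
- by_tape E.
- by lia.
move=> s3 Hs3; apply: (does_go Hs3) => [t||s4 Hs4].
- by [].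
- by lia.
- have := HQ _ Hs4; congr (Q _ _).
rewrite cell_mark //= /upd eqxx -aE -bE.
by case: ifP => /=; lia.
Qed.

(** One iteration takes a unit from [x] to the scratch tape and moves the input
    head by one row, whose length is measured on the counting tape. *)
Definition row_body (x : 'I_m) : frag tape_name (option unit) :=
  bind (walk (fun r => if r (var x) then (true, [:: var x], [:: tscratch])
                       else (false, [::], [::])))
  (fun b => if b then
    after (sweep tcount [::] [:: tcount; tin])
    (after (go [:: tcount] [::] tt)
    (after (sweep tcount [:: tcount] [::])
    (go [::] [:: tcount] None)))
  else go [::] [::] (Some tt)).

(** Rows first, then the column; after the entry is read, all heads go back. *)
Definition adj_frag (x y : 'I_m) : frag tape_name bool :=
  after (loop (row_body x))
  (after (sweep tscratch [:: tscratch] [:: var x])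
  (after (sweep (var y) [:: var y] [:: tin; tscratch])
  (bind (peek tin) (fun b =>
  (after (sweep tscratch [:: tscratch] [:: var y])
  (after (sweep tin [:: tin] [::])
  (go [::] [:: tin] b))))))).

Lemma does_rows G (q : 'I_m -> vertex G) x s (Q : unit -> tapes _ -> Prop)
    (a := nat_of_ord (enum_rank (q x))) :
    tapes_at (words G) (layout q) s ->
    (forall s', tapes_at (words G)
       (lay (Posz (a.+1 * nverts G)) 0 (Posz a) (upd (pos q) x (-1)%R)) s' -> Q tt s') ->
  does (loop (row_body x)) s ((nverts G).+1 * (2 * nverts G + 5)) Q.
Proof.
move=> Hs HQ; have lt_a : a < nverts G := rank_lt _.
have px : pos q x = Posz a by [].
set I := fun j s => j <= a.+1 /\ tapes_at (words G)
  (lay (Posz ((a.+1 - j) * nverts G)) 0 (a%:Z - j%:Z) (upd (pos q) x (j%:Z - 1)))%R s.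
suff HI j s1 : I j s1 -> does (row_body x) s1 (2 * nverts G + 5) (fun o s' =>
       if o is Some e then Q e s' else exists2 i, i < j & I i s').
  apply: does_weak (does_loop HI (j := a.+1) (s := s) _) _ (fun _ _ H => H); last first.
    by rewrite leq_mul2r ltnS lt_a orbT.
  split=> //; apply: tapes_at_eq Hs _; rewrite subnn mul0n.
  by case=> [[[|]|]|z] //=; rewrite /upd; [lia | case: eqP => [->|] //; rewrite px; lia].
(* The index [j] counts the cells from the left blank to the head of [x]. *)
move=> [le_j Hs1].
have mark_x : (cell (words G (var x)) (j%:Z - 1)%R : bool) = (0 < j).
  by rewrite cell_mark //; case: ifP => /=; lia.
apply: (does_bind (Q := fun b s' => b = (0 < j) /\ tapes_at (words G)
  (if b then lay (Posz ((a.+1 - j) * nverts G)) 0 (a%:Z - j%:Z + 1) (upd (pos q) x (j%:Z - 1 - 1))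
   else lay (Posz (a.+1 * nverts G)) 0 (Posz a) (upd (pos q) x (-1)))%R s')) (_ : 1 <= _) _.
- apply: does_walk Hs1 _; rewrite ffunE [lay _ _ _ _ _]/= [upd _ _ _ _]/upd eqxx mark_x.
  case: ifP => j0 s' Hs'; split=> //; apply: tapes_at_eq Hs' _.
  + by_tape (eqxx x).
  + have -> : j = 0 by lia.
    by rewrite subn0; by_tape (eqxx x).
- by lia.
move=> _ s2 [->]; case: ltnP => j0 Hs2; last first.
  by apply: (does_go Hs2) HQ => // ; lia.
have [M ME] : exists M, M = (a.+1 - j.-1) * nverts G by eexists.
set v := upd _ _ _ in Hs2; set t := (a%:Z - j%:Z + 1)%R in Hs2.
apply: (does_after_sweep_right (a := 0) (b := nverts G)
  (p' := lay (Posz M) (Posz (nverts G)) t v)%R) Hs2 _ _ _ _ _ _ _ => //.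
- by rewrite size_mark.
- have -> : M = nverts G + (a.+1 - j) * nverts G.
    by rewrite ME -mulSn; congr (_ * _); lia.
  by_tape (eqxx x).
- by lia.
move=> s3 Hs3; apply: (does_after_go (p' := lay (Posz M) (Posz (nverts G) - 1) t v)%R) Hs3 _ _ _.
- by_tape (eqxx x).
- by lia.
move=> s4 Hs4; apply: (does_after_sweep_left (a := nverts G)
  (p' := lay (Posz M) (-1) t v)%R) Hs4 _ _ _ _ _ _ => //.
- by rewrite /=; lia.
- by rewrite size_mark.
- by_tape (eqxx x).
- by lia.
move=> s5 Hs5; apply: (does_go Hs5
  (p' := lay (Posz M) 0 (a%:Z - j.-1%:Z) (upd (pos q) x (j.-1%:Z - 1)))%R).
- by rewrite /t /v; by_tape (eqxx x).
- by lia.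
move=> s6 Hs6; exists j.-1; first by lia.
by rewrite /I -ME; split=> //; lia.
Qed.

Lemma does_adj_frag G (q : 'I_m -> vertex G) x y s (Q : bool -> tapes _ -> Prop) :
    x != y ->
    tapes_at (words G) (layout q) s ->
    (forall s', tapes_at (words G) (layout q) s' -> Q (adj (q x) (q y)) s') ->
  does (adj_frag x y) s (3 * nverts G ^ 2 + 12 * nverts G + 20) Q.
Proof.
move=> xy Hs HQ.
have [a aE] : exists a, a = enum_rank (q x) :> nat by eexists.
have [b bE] : exists b, b = enum_rank (q y) :> nat by eexists.
have [lt_a lt_b] : a < nverts G /\ b < nverts G by rewrite aE bE !rank_lt.
have [px py] : pos q x = Posz a /\ pos q y = Posz b by rewrite /pos aE bE.
have E := (eqxx, negbTE xy, eq_sym y x, px, py).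
have sizeW : size (words G tin) = (nverts G).+1 + nverts G * nverts G by exact: size_encode.
have le_an : a.+1 * nverts G <= nverts G * nverts G by rewrite leq_mul2r lt_a orbT.
apply: (does_bind (Q := fun _ => tapes_at (words G)
  (lay (Posz (a.+1 * nverts G)) 0 (Posz a) (upd (pos q) x (-1)%R)))
  (t := (nverts G).+1 * (2 * nverts G + 5))).
- by apply: does_rows Hs _ => s'; rewrite -aE.
- by nia.
(* Products and the remaining time are named so that the side conditions
   become linear. *)
have [N NE] : exists N, N = a.+1 * nverts G by eexists.
have [u uE] : exists u, u =
    3 * nverts G ^ 2 + 12 * nverts G + 20 - (nverts G).+1 * (2 * nverts G + 5) by eexists.
have le_u : nverts G * nverts G + 5 * nverts G + 15 <= u by rewrite uE; nia.
rewrite -NE -uE in le_an *; move=> _ s1 Hs1.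
apply: (does_after_sweep_left (a := a.+1) (p' := lay (Posz N) 0 (-1) (pos q))) Hs1 _ _ _ _ _ _ => //.
- by rewrite /= -addn1 PoszD.
- by rewrite size_mark.
- by_tape E.
- by lia.
move=> s2 Hs2.
apply: (does_after_sweep_left (a := b.+1)
  (p' := lay (Posz (N + b.+1)) 0 (Posz b) (upd (pos q) y (-1)%R))) Hs2 _ _ _ _ _ _ => //.
- by rewrite inE.
- by rewrite /= py -addn1 PoszD.
- by rewrite size_mark.
- by_tape E.
- by lia.
move=> s3 Hs3; apply: (does_bind_peek Hs3); first by lia.
have -> : cell (words G tin) (Posz (N + b.+1)) = Some (inl (adj (q x) (q y))).
  by rewrite /= NE aE bE onth_encode.
have -> : (Some (inl (adj (q x) (q y))) == Some (inl true) :> sym) = adj (q x) (q y) by case: adj.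
move=> s4 Hs4.
apply: (does_after_sweep_left (a := b.+1) (p' := lay (Posz (N + b.+1)) 0 (-1) (pos q))) Hs4 _ _ _ _ _ _ => //.
- by rewrite /= -addn1 PoszD.
- by rewrite size_mark.
- by_tape E.
- by lia.
move=> s5 Hs5.
apply: (does_after_sweep_left (a := (N + b.+1).+1) (p' := lay (-1) 0 (-1) (pos q))) Hs5 _ _ _ _ _ _ => //.
- by rewrite /=; lia.
- by rewrite sizeW; lia.
- by_tape E.
- by lia.
move=> s6 Hs6; apply: (does_go Hs6 (p' := layout q)).
- by_tape E.
- by lia.
exact: HQ.
Qed.

(** * Preparing the tapes *)

(** The unary header of the input is copied to all the other tapes at once. *)
Definition fill_frag : frag tape_name unit :=
  loop (atom (fun r => if r tin == Some (inl true)
    then (None, [ffun i => (if i == tin then r i else Some (inl true), MoveRight)])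
    else (Some tt, [ffun i => (r i, Stay)]))).

Definition init_frag : frag tape_name unit :=
  after fill_frag
  (after (go (enum tape_name) [::] tt)
  (after (sweep tcount (enum tape_name) [::])
  (go [::] (filter (predC1 tscratch) (enum tape_name)) tt))).

Definition partial_words G j (i : tape_name) : seq bool :=
  if i == tin then encode G else nseq j true.

Lemma does_fill_frag G s (Q : unit -> tapes _ -> Prop) :
    tapes_at (partial_words G 0) (fun _ => 0%R) s ->
    (forall s', tapes_at (words G) (fun _ => Posz (nverts G)) s' -> Q tt s') ->
  does fill_frag s (nverts G).+1 Q.
Proof.
move=> Hs HQ; rewrite -[(nverts G).+1]muln1.
apply: (does_loop (I := fun j s => j <= nverts G /\
   tapes_at (partial_words G (nverts G - j)) (fun _ => Posz (nverts G - j)) s)); last first.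
  by rewrite subnn; split.
move=> j {Hs} {}s [le_j [Ws Hs]]; apply: does_atom.
have -> : scan s tin = if 0 < j then Some (inl true) else Some (inl false).
  rewrite ffunE Ws Hs /= /encode onth_cat size_nseq onth_nseq -/(nverts G).
  case: (posnP j) => [->|j0]; first by rewrite subn0 ltnn subnn.
  by have -> : nverts G - j < nverts G by lia.
case: ltnP => j0 /=; last first.
  have j_0 : j = 0 by lia.
  apply: HQ; split=> [i z | i] /=; rewrite !ffunE /= Hs j_0 subn0 //.
  by rewrite !Ws /partial_words j_0 subn0; case: eqP => [->|].
exists j.-1; first by lia.
have nj : nverts G - j.-1 = (nverts G - j).+1 by lia.
rewrite nj; split; first by lia.
split=> [i z | i] /=; rewrite !ffunE /= Hs; last by lia.
rewrite !Ws /partial_words; case: eqP => [->|zn]; case: (altP (i =P tin)) => // itin.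
  by rewrite /cell onth_nseq ltnSn.
case: z zn => // z zn; rewrite /cell !onth_nseq.
by have -> : (z < (nverts G - j).+1) = (z < nverts G - j) by lia.
Qed.

Lemma does_init_frag G (v0 : vertex G) s (Q : unit -> tapes _ -> Prop) :
    tapes_at (partial_words G 0) (fun _ => 0%R) s ->
    (forall (q : 'I_m -> vertex G) s', tapes_at (words G) (layout q) s' -> Q tt s') ->
  does init_frag s (2 * nverts G + 4) Q.
Proof.
move=> Hs HQ.
apply: (does_bind (Q := fun _ s' => tapes_at (words G) (fun _ => Posz (nverts G)) s')).
- by apply: does_fill_frag Hs _.
- by lia.
move=> _ s1 Hs1.
apply: (does_after_go (p' := fun _ => (Posz (nverts G) - 1)%R)) Hs1 _ _ _ => [i||s2 Hs2].
- by rewrite /moved mem_enum.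
- by lia.
apply: (does_after_sweep_left (a := nverts G) (p' := fun _ => (-1)%R)) Hs2 _ _ _ _ _ _.
- by rewrite mem_enum.
- by lia.
- by rewrite size_mark.
- by move=> i; rewrite /moved mem_enum /=; lia.
- by lia.
move=> s3 Hs3.
have n0 : 0 < nverts G by apply: leq_ltn_trans (rank_lt v0).
have rank0 : enum_rank (enum_val (Ordinal n0) : vertex G) = 0 :> nat.
  by rewrite (enum_valK (Ordinal n0)).
apply: (does_go Hs3 (p' := layout (fun _ => enum_val (Ordinal n0)))).
- case=> [[[|]|]|z]; rewrite /moved mem_filter mem_enum //=.
  by rewrite /pos rank0.
- by lia.
exact: HQ.
Qed.

(** * Evaluating first-order formulas *)

Definition poly_bounded (f : nat -> nat) : Prop :=
  exists p : {poly nat}, forall n, f n <= (p.[n])%R.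

Lemma poly_boundedC c : poly_bounded (fun _ => c).
Proof. by exists (c%:P)%R => n; rewrite hornerC. Qed.

Lemma poly_bounded_id : poly_bounded id.
Proof. by exists 'X%R => n; rewrite hornerX. Qed.

Lemma poly_boundedD f g :
  poly_bounded f -> poly_bounded g -> poly_bounded (fun n => f n + g n).
Proof. by move=> [p Hp] [q Hq]; exists (p + q)%R => n; rewrite hornerD leq_add. Qed.

Lemma poly_boundedM f g :
  poly_bounded f -> poly_bounded g -> poly_bounded (fun n => f n * g n).
Proof. by move=> [p Hp] [q Hq]; exists (p * q)%R => n; rewrite hornerM leq_mul. Qed.

Lemma leq_horner (p : {poly nat}) a b : a <= b -> (p.[a])%R <= (p.[b])%R.
Proof.
move=> le_ab; rewrite !horner_coef; apply: leq_sum => i _.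
apply: leq_mul => //; elim: (nat_of_ord i) => // k IH.
by rewrite !exprS; apply: leq_mul.
Qed.

(** Formulas are represented by their semantics.  Variable [i] is assigned to
    tape [i], and a formula at level [k] has its free variables below [k]. *)
Definition query := forall G : graph, (nat -> vertex G) -> Prop.

Definition agree G k (q : 'I_m -> vertex G) (e : nat -> vertex G) :=
  forall i : 'I_m, i < k -> q i = e i.

(** Only the variables below [k] are tied to the tapes, and only these are
    preserved.  As [e] is arbitrary elsewhere, a query with a correct fragment
    cannot depend on variables from [k] on. *)
Definition answers (F : frag tape_name bool) (T : nat -> nat) k (phi : query) :=
  forall G (e : nat -> vertex G) q s, agree k q e -> tapes_at (words G) (layout q) s ->
  does F s (T (nverts G)) (fun b s' => (b <-> phi G e) /\
    exists2 q' : 'I_m -> vertex G, agree k q' e & tapes_at (words G) (layout q') s').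

Definition computable k (phi : query) :=
  exists F T, poly_bounded T /\ answers F T k phi.

(** The source of all connectives.  The hypotheses are relative to the truth of
    [phi], which the machine has decided, so no excluded middle is involved. *)
Lemma computable_case k (phi psi1 psi2 chi : query) :
    computable k phi -> computable k psi1 -> computable k psi2 ->
    (forall G e, phi G e -> (psi1 G e <-> chi G e)) ->
    (forall G e, ~ phi G e -> (psi2 G e <-> chi G e)) ->
  computable k chi.
Proof.
move=> [F [T [PT HF]]] [F1 [T1 [PT1 HF1]]] [F2 [T2 [PT2 HF2]]] H1 H2.
exists (bind F (fun b => if b then F1 else F2)), (fun n => T n + (T1 n + T2 n)).
split; first by do 2?apply: poly_boundedD.
move=> G e q s qe Hs; apply: (does_bind (HF _ _ _ _ qe Hs)); first by lia.
rewrite addKn => -[] s' [b_phi [q' q'e Hs']].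
- apply: does_weak (HF1 _ _ _ _ q'e Hs') (leq_addr _ _) _ => b s2 [b1 ?]; split=> //.
  by rewrite -(H1 G e (proj1 b_phi isT)).
- apply: does_weak (HF2 _ _ _ _ q'e Hs') (leq_addl _ _) _ => b s2 [b1 ?]; split=> //.
  by rewrite -(H2 G e) // => /(proj2 b_phi).
Qed.

Lemma computable_const k (b : bool) : computable k (fun G e => b).
Proof.
exists (go [::] [::] b), (fun _ => 1); split; first exact: poly_boundedC.
move=> G e q s qe Hs; apply: (does_go Hs (p' := layout q)) => // s' Hs'.
by split=> //; exists q.
Qed.

Lemma computable_iff k (phi psi : query) :
  (forall G e, phi G e <-> psi G e) -> computable k phi -> computable k psi.
Proof.
by move=> H Hphi; apply: (computable_case (computable_const k true) Hphi Hphi).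
Qed.

Lemma computable_not k phi : computable k phi -> computable k (fun G e => ~ phi G e).
Proof.
move=> H; apply: (computable_case H (computable_const k false) (computable_const k true)).
  by move=> G e; split.
by move=> G e; split.
Qed.

Lemma computable_and k phi psi : computable k phi -> computable k psi ->
  computable k (fun G e => phi G e /\ psi G e).
Proof.
move=> H1 H2; apply: (computable_case H1 H2 (computable_const k false)) => G e; first tauto.
by split=> // -[].
Qed.

Lemma computable_or k phi psi : computable k phi -> computable k psi ->
  computable k (fun G e => phi G e \/ psi G e).
Proof.
move=> H1 H2; apply: (computable_case H1 (computable_const k true) H2) => G e; last tauto.
by split=> //; left.
Qed.

Lemma computable_all k n (phi : nat -> query) :
  (forall i, i < n -> computable k (phi i)) ->
  computable k (fun G e => forall i, i < n -> phi i G e).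
Proof.
elim: n => [|n IH] H; first by apply: computable_iff (computable_const k true) => G e; split.
have H' := computable_and (IH (fun i lt_in => H i (ltnW lt_in))) (H n (ltnSn n)).
apply: computable_iff H' => G e; split=> [[Hlt Hn] i | Hlt].
  by rewrite ltnS leq_eqVlt => /orP[/eqP-> | /Hlt].
by split=> [i lt_in|]; apply: Hlt => //; apply: ltnW.
Qed.

Lemma computable_some k n (phi : nat -> query) :
  (forall i, i < n -> computable k (phi i)) ->
  computable k (fun G e => exists2 i, i < n & phi i G e).
Proof.
elim: n => [|n IH] H.
  by apply: computable_iff (computable_const k false) => G e; split=> // -[].
have H' := computable_or (IH (fun i lt_in => H i (ltnW lt_in))) (H n (ltnSn n)).
apply: computable_iff H' => G e; split=> [[[i lt_in Hi]|Hn] | [i]].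
- by exists i => //; apply: ltnW.
- by exists n.
- by rewrite ltnS leq_eqVlt => /orP[/eqP-> | lt_in Hi]; [right | left; exists i].
Qed.

Section Atoms.
Variables (k i j : nat).
Hypotheses (le_km : k <= m) (lt_ik : i < k) (lt_jk : j < k) (ij : i != j).

Lemma computable_adj : computable k (fun G e => adj (e i) (e j)).
Proof.
have lt_im := leq_trans lt_ik le_km; have lt_jm := leq_trans lt_jk le_km.
exists (adj_frag (Ordinal lt_im) (Ordinal lt_jm)), (fun n => 3 * (n * n) + 12 * n + 20); split.
  by do ?[apply: poly_boundedD | apply: poly_boundedM | apply: poly_boundedC | apply: poly_bounded_id].
move=> G e q s qe Hs; apply: does_adj_frag Hs _ => // s' Hs'.
by rewrite !qe //; split=> //; exists q.
Qed.

Lemma computable_leq : computable k (fun G e => enum_rank (e j) <= enum_rank (e i)).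
Proof.
have lt_im := leq_trans lt_ik le_km; have lt_jm := leq_trans lt_jk le_km.
exists (leq_frag (Ordinal lt_im) (Ordinal lt_jm)), (fun n => 2 * n + 4); split.
  by do ?[apply: poly_boundedD | apply: poly_boundedM | apply: poly_boundedC | apply: poly_bounded_id].
move=> G e q s qe Hs; apply: does_leq_frag Hs _ => // s' Hs'.
by rewrite !qe //; split=> //; exists q.
Qed.

End Atoms.

Lemma computable_eq k i j : k <= m -> i < k -> j < k -> i != j ->
  computable k (fun G e => e i = e j).
Proof.
move=> le_km lt_ik lt_jk ij; have ji : j != i by rewrite eq_sym.
have := computable_and (computable_leq le_km lt_ik lt_jk ij) (computable_leq le_km lt_jk lt_ik ji).
apply: computable_iff => G e; split=> [[le1 le2] | ->]; last by [].
by apply/enum_rank_inj/val_inj/eqP; rewrite /= eqn_leq le1 le2.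
Qed.

(** The search stops at the first witness, or when the head of [x] has run past
    the last mark; it is then put back on the last mark, because a head at rest
    always denotes a vertex. *)
Definition ex_frag (x : 'I_m) (F : frag tape_name bool) : frag tape_name bool :=
  after (sweep (var x) [:: var x] [::])
  (after (go [::] [:: var x] tt)
  (loop (bind F (fun b => if b then go [::] [::] (Some true) else
    after (go [::] [:: var x] tt)
    (bind (peek (var x)) (fun b =>
     if b then go [::] [::] None else go [:: var x] [::] (Some false))))))).

Lemma agree_upd G k (lt_km : k < m) (q : 'I_m -> vertex G) e :
  agree k q e -> agree k.+1 q (upd e k (q (Ordinal lt_km))).
Proof.
move=> qe i; rewrite ltnS leq_eqVlt /upd => /orP[/eqP ik | lt_ik].
  by rewrite ik eqxx; congr q; apply: val_inj.
by rewrite ltn_eqF // qe.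
Qed.

Lemma agree_low G k (q : 'I_m -> vertex G) e v :
  agree k.+1 q (upd e k v) -> agree k q e.
Proof. by move=> qe i lt_ik; rewrite qe 1?ltnW // /upd ltn_eqF. Qed.

Lemma computable_ex k phi : k < m -> computable k.+1 phi ->
  computable k (fun G e => exists x, phi G (upd e k x)).
Proof.
move=> lt_km [F [T [PT HF]]]; set x := Ordinal lt_km.
exists (ex_frag x F), (fun n => (n + 2) + n.+1 * (T n + 3)); split.
  by do ?[apply: poly_boundedD | apply: poly_boundedM | apply: poly_boundedC | apply: poly_bounded_id
           | apply: (@poly_boundedD (fun _ => 1))].
move=> G e q s qe Hs.
have lt_q := rank_lt (q x).
apply: (does_after_sweep_left (a := (enum_rank (q x)).+1)
  (p' := lay 0 0 (-1) (upd (pos q) x (-1)%R))) Hs _ _ _ _ _ _.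
- by rewrite inE.
- by rewrite /= /pos -addn1 PoszD.
- by rewrite size_mark.
- have px : pos q x = Posz (enum_rank (q x)) by [].
  by_tape (eqxx x, px).
- by lia.
move=> s1 Hs1.
have n0 : 0 < nverts G by lia.
have valK i (lt_i : i < nverts G) : enum_rank (enum_val (Ordinal lt_i) : vertex G) = i :> nat.
  by rewrite (enum_valK (Ordinal lt_i)).
have agree_set q' v : agree k q' e -> agree k (upd q' x v) e.
  move=> q'e i lt_ik; rewrite /upd; case: eqP lt_ik => [->|_]; last exact: q'e.
  by rewrite ltnn.
apply: (does_after_go (p' := layout (upd q x (enum_val (Ordinal n0))))) Hs1 _ _ _.
- case=> [[[|]|]|z] //; rewrite /moved /= ?inE ?eq_var /pos /upd.
  by case: eqP => // _; rewrite valK.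
- by lia.
move=> s2 Hs2.
(* Here [j] is the number of vertices still to be tried. *)
set I := fun j s => exists q' : 'I_m -> vertex G, [/\ j <= nverts G, agree k q' e,
  tapes_at (words G) (layout q') s, enum_rank (q' x) = nverts G - j :> nat &
  forall y, enum_rank y < nverts G - j -> ~ phi G (upd e k y)].
apply: does_weak (does_loop (I := I) (j := nverts G) (t := T (nverts G) + 3) _ _) _ (fun _ _ H => H);
  last 1 first.
- by lia.
- move=> j s3 [q1 [le_j q1e Hs3 rank_q1 Hno]].
  apply: (does_bind (HF _ _ _ _ (agree_upd lt_km q1e) Hs3)); first by lia.
  have lt_q1 := rank_lt (q1 x).
  move=> [] s4 [b_phi [q2 q2e Hs4]].
    apply: (does_go Hs4 (p' := layout q2)) => //; first by lia.
    move=> s5 Hs5; split; last by exists q2 => //; apply: agree_low q2e.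
    by split=> // _; exists (q1 x); apply/b_phi.
  have q2x : q2 x = q1 x by rewrite q2e //= /upd eqxx.
  have {}q2e : agree k q2 e by apply: agree_low q2e.
  have p2x : pos q2 x = (nverts G - j)%N by rewrite /pos q2x rank_q1.
  apply: (does_after_go (p' := lay 0 0 (-1) (upd (pos q2) x (Posz (nverts G - j).+1)))) Hs4 _ _ _.
  - by_tape (eqxx x, p2x).
  - by lia.
  move=> s5 Hs5; apply: (does_bind_peek Hs5); first by lia.
  have Hno' y : enum_rank y < (nverts G - j).+1 -> ~ phi G (upd e k y).
    rewrite ltnS leq_eqVlt => /orP[/eqP rank_y | /Hno //].
    suff -> : y = q1 x by move/b_phi.
    by apply/enum_rank_inj/val_inj; rewrite /= rank_y rank_q1.
  have -> : (cell (words G (var x))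
      (lay 0 0 (-1) (upd (pos q2) x (Posz (nverts G - j).+1)) (var x)) == Some (inl true))
      = ((nverts G - j).+1 < nverts G).
    by rewrite cell_mark //= /upd eqxx ltz_nat; case: ltnP.
  case: ltnP => [lt_n | le_n] s6 Hs6.
  + apply: (does_go Hs6 (p' := layout (upd q2 x (enum_val (Ordinal lt_n))))).
    * case=> [[[|]|]|z] //; rewrite /moved /= /pos /upd.
      by case: eqP => // _; rewrite valK.
    * by lia.
    move=> s7 Hs7; exists j.-1; first by lia.
    have nj : nverts G - j.-1 = (nverts G - j).+1 by lia.
    exists (upd q2 x (enum_val (Ordinal lt_n))); rewrite nj; split=> //; first by lia.
    * exact: agree_set.
    * by rewrite /upd eqxx valK.
  + apply: (does_go Hs6 (p' := layout q2)).
    * by_tape (eqxx x, p2x).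
    * by lia.
    move=> s7 Hs7; split; last by exists q2.
    split=> // -[y Hphi]; have lt_y := rank_lt y.
    by exfalso; apply: (Hno' y) Hphi; lia.
- exists (upd q x (enum_val (Ordinal n0))); split=> //.
  + exact: agree_set.
  + by rewrite /upd eqxx valK subnn.
  + by move=> y; rewrite subnn.
Qed.

(** Iterated updates, in the order in which a block of quantifiers makes them. *)
Fixpoint upds (V : Type) (e : nat -> V) k (xs : seq V) : nat -> V :=
  if xs is x :: xs' then upds (upd e k x) k.+1 xs' else e.

Lemma computable_exs n k phi : k + n <= m -> computable (k + n) phi ->
  computable k (fun G e => exists2 xs, size xs = n & phi G (upds e k xs)).
Proof.
elim: n k => [|n IH] k.
  rewrite addn0 => _; apply: computable_iff => G e; split=> [H | [[]]] //.
  by exists [::].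
rewrite addnS -addSn => le_m /(IH _ le_m) H.
have lt_km : k < m by apply: leq_trans le_m; rewrite ltnS leq_addr.
apply: computable_iff (computable_ex lt_km H) => G e; split.
  by move=> [x [xs <- Hxs]]; exists (x :: xs).
by move=> [[//|x xs] [sz] Hxs]; exists x, xs.
Qed.

(** A sentence is at level 0, where no variable is tied to its tape, so the
    variables may start with any values. *)
Lemma computable_solvable (C Q : graph -> Prop) phi :
    computable 0 phi ->
    (forall G, C G -> exists v : vertex G, phi G (fun _ => v) <-> Q G) ->
  poly_time_solvable_on encode C Q.
Proof.
move=> [F [T [PT HF]]] CQ.
have [p Hp] : poly_bounded (fun n => 2 * n + 4 + T n).
  by do ?[apply: poly_boundedD | apply: poly_boundedM | apply: poly_boundedC | apply: poly_bounded_id].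
exists (frag_machine (after init_frag F) tin), p => G /CQ [v phiQ].
pose s0 := Tapes (content (init (frag_machine (after init_frag F) tin) (encode G)))
  (head_pos (init (frag_machine (after init_frag F) tin) (encode G))).
have Hs0 : tapes_at (partial_words G 0) (fun _ => 0%R) s0.
  split=> // i z; rewrite /partial_words /=; case: eqP => //= _.
  by case: z => z //=; rewrite onth0n.
have : does (after init_frag F) s0 (2 * nverts G + 4 + T (nverts G)) (fun b s' => b <-> phi G (fun _ => v)).
  apply: (does_bind (Q := fun _ s' => exists q : 'I_m -> vertex G, tapes_at (words G) (layout q) s')).
  - by apply: (does_init_frag v Hs0) => q s' Hs'; exists q.
  - exact: leq_addr.
  move=> _ s1 [q Hs1]; rewrite addKn.
  by apply: does_weak (HF _ (fun _ => v) q _ _ Hs1) _ _ => // b s' [].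
move/(does_iter tin) => [t [b [s' [le_t Hb b_phi]]]]; exists t, b; split.
- apply: leq_trans le_t (leq_trans (Hp _) (leq_horner _ _)).
  by rewrite size_encode addSn ltnW // ltnS leq_addr.
- exact: Hb.
- exact: iff_trans phiQ.
Qed.

End Evaluation.

(** * The existence of a d-cut as a first-order sentence *)

Lemma upds_low (V : Type) (e : nat -> V) k xs i : i < k -> upds e k xs i = e i.
Proof.
elim: xs e k => [|x xs IH] e k lt_ik //=; rewrite IH ?leqW //.
by rewrite /upd ltn_eqF.
Qed.

Lemma upds_nth (V : Type) (e : nat -> V) k x0 xs i : i < size xs ->
  upds e k xs (k + i) = nth x0 xs i.
Proof.
elim: xs e k i => [|x xs IH] e k [|i] //= lt_i.
  by rewrite addn0 upds_low // /upd eqxx.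
by rewrite addnS -addSn IH.
Qed.

(** Variables below [d] stand for the [x_i], the next [d * d] for the [y_j];
    the formula says that variable [l] lies in the closed neighbourhood of the
    [x_i] minus the [y_j]. *)
Definition in_side d l : query := fun G e =>
  (exists2 i, i < d & e l = e i \/ adj (e i) (e l)) /\
  (forall j, j < d * d -> e l <> e (d + j)).

Definition differ (phi psi : query) : query := fun G e =>
  phi G e /\ ~ psi G e \/ ~ phi G e /\ psi G e.

(** The [d + 1] variables after [k] are distinct neighbours of variable [k]
    across the cut. *)
Definition many_crossing d k : query := fun G e =>
  (forall i, i < d.+1 -> adj (e k) (e (k.+1 + i)) /\
     differ (in_side d (k.+1 + i)) (in_side d k) e) /\
  (forall i, i < d.+1 -> forall j, j < i -> e (k.+1 + i) <> e (k.+1 + j)).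

Definition is_cut d : query := let k := d + d * d in fun G e =>
  [/\ exists z, in_side d k (upd e k z), exists z, ~ in_side d k (upd e k z) &
    ~ exists u, exists2 zs, size zs = d.+1 & many_crossing d k (upds (upd e k u) k.+1 zs)].

Definition has_cut d : query := fun G e =>
  exists2 xs, size xs = d + d * d & is_cut d (upds e 0 xs).

Lemma computable_in_side m d l k : k <= m -> l < k -> d + d * d <= l ->
  computable m k (in_side d l).
Proof.
move=> le_km lt_lk le_dl; rewrite /in_side; apply: computable_and.
- apply: computable_some => i lt_id; apply: computable_or.
    by apply: computable_eq => //; lia.
  by apply: computable_adj => //; lia.
- apply: computable_all => j lt_j; apply: computable_not.
  by apply: computable_eq => //; lia.
Qed.

Lemma computable_differ m k phi psi : computable m k phi -> computable m k psi ->
  computable m k (differ phi psi).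
Proof.
move=> Hphi Hpsi; rewrite /differ; apply: computable_or;
  by apply: computable_and => //; apply: computable_not.
Qed.

Lemma computable_has_cut d : computable ((d + d * d).+1 + d.+1) 0 (has_cut d).
Proof.
set k := d + d * d; set m := _ + _.
apply: computable_exs; rewrite ?add0n -/k; first by lia.
have side n l : n <= m -> l < n -> k <= l -> computable m n (in_side d l).
  exact: computable_in_side.
have H : computable m k (fun G e => (exists z, in_side d k (upd e k z)) /\
   (exists z, ~ in_side d k (upd e k z)) /\
   ~ exists u, exists2 zs, size zs = d.+1 & many_crossing d k (upds (upd e k u) k.+1 zs)).
  apply: computable_and; last apply: computable_and.
  - by apply: computable_ex; [lia | apply: side; lia].
  - apply: (computable_ex (phi := fun G e => ~ in_side d k e)); first by lia.
    by apply: computable_not; apply: side; lia.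
  apply: computable_not.
  apply: (computable_ex (phi := fun G e =>
    exists2 zs, size zs = d.+1 & many_crossing d k (upds e k.+1 zs))); first by lia.
  apply: computable_exs => //; rewrite /many_crossing; apply: computable_and.
    apply: computable_all => i lt_i; apply: computable_and.
      by apply: computable_adj => //; lia.
    by apply: computable_differ; apply: side; lia.
  apply: computable_all => i lt_i; apply: computable_all => j lt_j; apply: computable_not.
  by apply: computable_eq => //; lia.
by apply: computable_iff H => G e; split=> [[? [? ?]] | [? ? ?]].
Qed.

Section Meaning.

Variables (d : nat) (G : graph) (D R : seq (vertex G)).
Hypotheses (szD : size D = d) (szR : size R = d * d).
Let k := d + d * d.

(** The variables below [k] list the [x_i] and the [y_j]. *)
Definition encodes (e : nat -> vertex G) := forall x0 i, i < k -> e i = nth x0 (D ++ R) i.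

Lemma in_sideP l e : encodes e -> in_side d l e <-> e l \in cut_side D R.
Proof.
move=> eDR; pose x0 := e l.
have eD i : i < d -> e i = nth x0 D i.
  by move=> lt_i; rewrite (eDR x0) ?nth_cat ?szD ?lt_i // /k; lia.
have eR j : j < d * d -> e (d + j) = nth x0 R j.
  by move=> lt_j; rewrite (eDR x0) ?nth_cat ?szD ?addKn 1?ltnNge ?leq_addr // /k; lia.
rewrite inE; split=> [[[i lt_i Hi] Hno] | /andP[/hasP[y yD Hy] xR]].
  apply/andP; split.
    apply/hasP; exists (e i); first by rewrite eD // mem_nth ?szD.
    by case: Hi => [->|->]; rewrite ?eqxx ?orbT.
  apply/negP => /(nthP x0)[j]; rewrite szR => lt_j; rewrite -eR // => ejE.
  by apply: (Hno j lt_j); rewrite ejE.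
split.
  move: yD Hy => /(nthP x0)[i]; rewrite szD => lt_i; rewrite -eD // => <- Hi.
  by exists i => //; case/orP: Hi => [/eqP|]; [left | right].
by move=> j lt_j xE; case/negP: xR; rewrite xE eR // mem_nth ?szR.
Qed.

Lemma encodes_upd e u : encodes e -> encodes (upd e k u).
Proof. by move=> eDR x0 i lt_i; rewrite /upd ltn_eqF // -eDR. Qed.

Lemma differP l1 l2 e : encodes e -> differ (in_side d l1) (in_side d l2) e <->
  (e l1 \in cut_side D R) != (e l2 \in cut_side D R).
Proof.
move=> eDR; rewrite /differ !(in_sideP _ eDR).
by case: (e l1 \in _); case: (e l2 \in _); split=> //; (try by [left | right | case=> -[]]); intuition.
Qed.

Lemma many_crossingP e u : encodes e ->
  (exists2 zs, size zs = d.+1 & many_crossing d k (upds (upd e k u) k.+1 zs)) <->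
  d < #|crossing (cut_side D R) u|.
Proof.
move=> eDR.
have enc zs : encodes (upds (upd e k u) k.+1 zs).
  by move=> x0 i lt_i; rewrite upds_low ?leqW // (encodes_upd u eDR x0).
have eu zs : upds (upd e k u) k.+1 zs k = u by rewrite upds_low // /upd eqxx.
split=> [[zs sz [Hadj Hneq]] | lt_d].
- rewrite -[d.+1]sz; have /card_uniqP <- : uniq zs.
    apply/(uniqPn u) => -[j [i [lt_ji lt_i eqz]]].
    rewrite sz in lt_i; apply: (Hneq i lt_i j lt_ji).
    by rewrite !(upds_nth _ _ u) ?sz //; lia.
  rewrite subset_leq_card //; apply/subsetP => z /(nthP u)[i lt_i <-]; rewrite inE.
  rewrite sz in lt_i; have [] := Hadj i lt_i; rewrite differP // eu.
  by rewrite !(upds_nth _ _ u) ?sz // => ->.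
- set S := crossing _ _ in lt_d; pose zs := take d.+1 (enum S).
  have sz : size zs = d.+1 by rewrite size_takel // -cardE.
  have uz : uniq zs by rewrite take_uniq // enum_uniq.
  exists zs => //; split=> i lt_i.
    have : nth u zs i \in S by rewrite -mem_enum (mem_take (mem_nth _ _)) // sz.
    rewrite inE -(upds_nth (upd e k u) k.+1 u (xs := zs)) ?sz // => /andP[].
    by rewrite eu => -> Hd; split=> //; apply/differP; rewrite ?eu.
  move=> j lt_j; rewrite !(upds_nth _ _ u) ?sz //; last by lia.
  by apply/eqP; rewrite nth_uniq ?sz //; lia.
Qed.

Lemma is_cutP e : encodes e -> is_cut d e <-> dcut d (cut_side D R).
Proof.
move=> eDR; rewrite /is_cut -/k.
have side z : in_side d k (upd e k z) <-> z \in cut_side D R.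
  by rewrite (in_sideP _ (encodes_upd z eDR)) /upd eqxx.
split=> [[[z /side zB] [z' z'B] Hno] | [[z zB] [z' z'B] Hle]]; split.
- by exists z.
- by exists z'; apply/negP => /side.
- move=> u; rewrite leqNgt; apply/negP => lt_d; apply: Hno; exists u.
  exact/many_crossingP.
- by exists z; apply/side.
- by exists z' => /side; rewrite (negbTE z'B).
- by move=> [u /(many_crossingP u eDR)]; rewrite ltnNge Hle.
Qed.

End Meaning.

Lemma has_cutP d G v : 0 < d -> bipartite G -> radius_at_most G 2 ->
  has_cut d (fun _ : nat => v : vertex G) <-> has_dcut d G.
Proof.
move=> d0 biG radG.
have enc (D R : seq (vertex G)) e : size D = d -> size R = d * d -> encodes d D R (upds e 0 (D ++ R)).
  move=> szD szR x0 i lt_i; rewrite -[i in LHS]add0n (upds_nth _ _ x0) //.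
  by rewrite size_cat szD szR.
split=> [[xs sz] | /(dcut_few_vertices d0 biG radG)[D [R [szD szR cutDR]]]].
  have szD : size (take d xs) = d by rewrite size_takel // sz leq_addr.
  have szR : size (drop d xs) = d * d by rewrite size_drop sz addKn.
  rewrite -(cat_take_drop d xs) => /(is_cutP szD szR (enc _ _ _ szD szR)) H.
  by apply/has_dcutP; eexists; apply: H.
exists (D ++ R); first by rewrite size_cat szD szR.
exact/(is_cutP szD szR (enc _ _ _ szD szR)).
Qed.

Theorem theorem14 (d : nat) (hd : (1 <= d)%N) :
  poly_time_solvable_on encode
    (fun G : graph => bipartite G /\ radius_at_most G 2)
    (fun G : graph => has_dcut d G).
Proof.
apply: computable_solvable (computable_has_cut d) _ => G [biG radG].
by have [v _] := radG; exists v; apply: has_cutP.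
Qed.
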